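(* Let $\Lambda\in\mathbb{R}^{p\times p}$ be a discrete-time interconnection. There exists $\alpha>0$ such that for every $Q:\mathbb{N}\to\overline{\mathcal Q}_n$, the solution of $\mathbf x^+=(I_{np}+(\Lambda-I_p)\otimes Q_k)\mathbf x$ satisfies $|\mathbf x(k)|\le\alpha|\mathbf x(0)|$ for all $k\in\mathbb{N}$.
   Context: $|\cdot|$ Euclidean / induced 2-norm; $\otimes$ Kronecker product; $\overline{\mathcal Q}_n$ the set of symmetric positive semidefinite $n\times n$ matrices $R$ with $|R|\le1$. A discrete-time interconnection is $\Lambda=[\lambda_{ij}]$ with $\lambda_{ij}\ge0$ and $\sum_j\lambda_{ij}=1$ for all $i$. Equivalently, with $\mathbf x=[x_1^T\cdots x_p^T]^T$, the system is $x_i^+=x_i+Q_k\sum_{j\ne i}\lambda_{ij}(x_j-x_i)$. *)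

(* Defs.v *)
From mathcomp Require Import all_boot all_order all_algebra.
From mathcomp Require Import reals.
Set Implicit Arguments. Unset Strict Implicit. Unset Printing Implicit Defensive.
Import Order.TTheory GRing.Theory Num.Theory.
Local Open Scope ring_scope.

Section Defs.
Variable R : realType.

Lemma kron_div_proof m n (k : 'I_(m * n)) : (k %/ n < m)%N.
Proof.
have := ltn_ord k; move: (nat_of_ord k) => {}k.
by case: n => [|n]; [rewrite muln0 | move=> H; rewrite ltn_divLR].
Qed.

Lemma kron_mod_proof m n (k : 'I_(m * n)) : (k %% n < n)%N.
Proof.
have := ltn_ord k; move: (nat_of_ord k) => {}k.
by case: n => [|n]; [rewrite muln0 | rewrite ltn_mod].
Qed.

Definition kdiv m n (k : 'I_(m * n)) : 'I_m := Ordinal (kron_div_proof k).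
Definition kmod m n (k : 'I_(m * n)) : 'I_n := Ordinal (kron_mod_proof k).

(* Kronecker product A ⊗ B, standard block layout:
   (A ⊗ B)_{(a-1)n2 + b, (c-1)q + d} = A_{a c} B_{b d}. *)
Definition kron m1 n1 m2 n2 (A : 'M[R]_(m1, n1)) (B : 'M[R]_(m2, n2))
  : 'M[R]_(m1 * m2, n1 * n2) :=
  \matrix_(i, j) (A (kdiv i) (kdiv j) * B (kmod i) (kmod j)).

Definition vnorm m (x : 'cV[R]_m) : R := Num.sqrt (\sum_i x i 0 ^+ 2).

Definition opnorm_le n (M : 'M[R]_n) (c : R) : Prop :=
  forall x : 'cV[R]_n, vnorm (M *m x) <= c * vnorm x.

Definition Qbar n (Q : 'M[R]_n) : Prop :=
  Q^T = Q /\
  (forall x : 'cV[R]_n, 0 <= (x^T *m Q *m x) 0 0) /\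
  opnorm_le Q 1.

Definition interconnection p (L : 'M[R]_p) : Prop :=
  (forall i j, 0 <= L i j) /\ (forall i, \sum_j L i j = 1).

Fixpoint traj p n (L : 'M[R]_p) (Q : nat -> 'M[R]_n) (x0 : 'cV[R]_(p * n))
  (k : nat) : 'cV[R]_(p * n) :=
  match k with
  | 0 => x0
  | k'.+1 => (1%:M + kron (L - 1%:M) (Q k')) *m traj L Q x0 k'
  end.

End Defs.

(* Main.v *)
(** Row stochasticity makes [L] a contraction for the sup norm, so its eigenvalues
    lie in the closed unit disc and those on the unit circle are semisimple.
    Splitting off unit eigenvectors one at a time, and using a Lyapunov form for
    the remaining part of spectral radius < 1, we get an injective complex matrix
    [T] with [|T L v| <= |T v|] in the Euclidean norm.  Reshape the state as a
    [p x n] matrix [X], so that [X+ = X + (L - 1) X Q].  In an orthonormal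
    eigenbasis of [Q] each column evolves by [z+ = (1 - d) z + d L z] with [d] an
    eigenvalue of [Q], hence in [0, 1]; by convexity of the squared norm the
    Frobenius norm of [T X] never increases, whatever the sequence of [Q]'s. *)
Require Import Defs.
From mathcomp Require Import all_boot all_order all_algebra.
From mathcomp Require Import boolp reals complex ring lra.
Import Order.TTheory GRing.Theory Num.Theory.
Local Open Scope ring_scope.
Local Open Scope complex_scope.
Set Implicit Arguments. Unset Strict Implicit. Unset Printing Implicit Defensive.

(** * Squared moduli and squared Frobenius norms *)

Definition sqn (R : rcfType) (z : R[i]) : R :=
  complex.Re z ^+ 2 + complex.Im z ^+ 2.

Definition frob (R : rcfType) m n (A : 'M[R[i]]_(m, n)) : R :=
  \sum_i \sum_j sqn (A i j).

Lemma sqn_ge0 (R : rcfType) (z : R[i]) : 0 <= sqn z.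
Proof. by rewrite addr_ge0 ?sqr_ge0. Qed.

Lemma sqnM (R : rcfType) (y z : R[i]) : sqn (y * z) = sqn y * sqn z.
Proof. by case: y z => a b [c d]; rewrite /sqn /=; ring. Qed.

Lemma sqn_real (R : rcfType) (x : R) : sqn x%:C = x ^+ 2.
Proof. by rewrite /sqn /= expr0n addr0. Qed.

Lemma sqn_normC (R : rcfType) (z : R[i]) : (sqn z)%:C = `|z| ^+ 2.
Proof. exact: add_Re2_Im2. Qed.

(** The gap between the two sides is [t * (1 - t)] times the squared modulus of [y - z]. *)
Lemma sqn_conv (R : rcfType) (t : R) (y z : R[i]) : 0 <= t <= 1 ->
  sqn ((1 - t)%:C * y + t%:C * z) <= (1 - t) * sqn y + t * sqn z.
Proof.
move=> /andP[t0 t1]; case: y z => a b [c d]; rewrite /sqn /= !mul0r !subr0.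
rewrite !addr0 -subr_ge0.
have -> : (1 - t) * (a ^+ 2 + b ^+ 2) + t * (c ^+ 2 + d ^+ 2) -
    (((1 - t) * a + t * c) ^+ 2 + ((1 - t) * b + t * d) ^+ 2) =
  t * (1 - t) * ((a - c) ^+ 2 + (b - d) ^+ 2) by ring.
by rewrite mulr_ge0 ?addr_ge0 ?sqr_ge0 // mulr_ge0 // subr_ge0.
Qed.

Lemma frob_ge0 (R : rcfType) m n (A : 'M[R[i]]_(m, n)) : 0 <= frob A.
Proof. by do 2![apply: sumr_ge0 => ? _]; apply: sqn_ge0. Qed.

Lemma frobZ (R : rcfType) m n (a : R[i]) (A : 'M[R[i]]_(m, n)) :
  frob (a *: A) = sqn a * frob A.
Proof.
rewrite /frob mulr_sumr; apply: eq_bigr => i _; rewrite mulr_sumr.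
by apply: eq_bigr => j _; rewrite mxE sqnM.
Qed.

Lemma frob_conv (R : rcfType) m n (t : R) (A B : 'M[R[i]]_(m, n)) :
  0 <= t <= 1 ->
  frob ((1 - t)%:C *: A + t%:C *: B) <= (1 - t) * frob A + t * frob B.
Proof.
move=> t01; rewrite /frob !mulr_sumr -big_split; apply: ler_sum => i _ /=.
rewrite !mulr_sumr -big_split; apply: ler_sum => j _ /=.
by rewrite !mxE sqn_conv.
Qed.

(** Weighted Young inequality: convexity applied to [A] divided by [1 - t] and [B] divided by
    [t]. *)
Lemma frobD_le (R : rcfType) m n (t : R) (A B : 'M[R[i]]_(m, n)) :
  0 < t < 1 ->
  frob (A + B) <= (1 - t)^-1 * frob A + t^-1 * frob B.
Proof.
move=> /andP[t0 t1]; have u0 : 0 < 1 - t by rewrite subr_gt0.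
have -> : A + B = (1 - t)%:C *: ((1 - t)^-1%:C *: A) + t%:C *: (t^-1%:C *: B).
  by rewrite !scalerA -!rmorphM /= !mulfV ?gt_eqF // rmorph1 !scale1r.
apply: le_trans (frob_conv _ _ _) _; first by rewrite !ltW.
by rewrite !frobZ !sqn_real !mulrA !mulfV ?gt_eqF // !mul1r.
Qed.

Lemma frob_col_mx (R : rcfType) m1 m2 n (A : 'M[R[i]]_(m1, n))
    (B : 'M[R[i]]_(m2, n)) : frob (col_mx A B) = frob A + frob B.
Proof.
rewrite /frob big_split_ord; congr (_ + _); apply: eq_bigr => i _;
  by apply: eq_bigr => j _; rewrite ?col_mxEu ?col_mxEd.
Qed.

Lemma frob_cols (R : rcfType) m n (A : 'M[R[i]]_(m, n)) :
  frob A = \sum_j frob (col j A).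
Proof.
rewrite /frob exchange_big /=; apply: eq_bigr => j _.
by apply: eq_bigr => i _; rewrite big_ord1 mxE.
Qed.

(** In the trace form a unitary right factor cancels against its adjoint. *)
Lemma frob_trC (R : rcfType) m n (A : 'M[R[i]]_(m, n)) :
  (frob A)%:C = \tr (A *m map_mx Num.conj A^T).
Proof.
rewrite /frob rmorph_sum /=; apply: eq_bigr => i _.
rewrite mxE rmorph_sum /=; apply: eq_bigr => j _.
by rewrite !mxE sqn_normC normCK.
Qed.

Lemma frob_unitary (R : rcfType) m n (A : 'M[R[i]]_(m, n)) (U : 'M[R[i]]_n) :
  U \is unitarymx -> frob (A *m U) = frob A.
Proof.
move=> /unitarymxP UU; apply: (@complexI R); rewrite !frob_trC.
by rewrite trmx_mul map_mxM mulmxA -(mulmxA A) UU mulmx1.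
Qed.

(** Any finite constant will do, so the columns of [A] are peeled off one by one: a single column
    contributes an outer product, whose [frob] is exactly a product, and [frobD_le] at 1/2 costs a
    factor 2. *)
Lemma frob_mul_le (R : rcfType) m n (A : 'M[R[i]]_(m, n)) :
  exists2 c : R, 0 <= c &
    forall q (V : 'M[R[i]]_(n, q)), frob (A *m V) <= c * frob V.
Proof.
elim: n A => [|n IHn] A.
  exists 0 => // q V; have -> : A *m V = 0.
    by apply/matrixP => i j; rewrite !mxE big_ord0.
  rewrite mul0r /frob big1 // => i _; rewrite big1 // => j _.
  by rewrite mxE /sqn /= expr0n addr0.
rewrite -[n.+1]/(1 + n)%N in A *.
have [c c0 cP] := IHn (rsubmx A).
exists (2 * (frob (lsubmx A) + c)); first by rewrite mulr_ge0 ?addr_ge0 ?frob_ge0.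
move=> q V; rewrite -{1}(hsubmxK A) -(vsubmxK V) mul_row_col frob_col_mx.
have lcol : frob (lsubmx A *m usubmx V) = frob (lsubmx A) * frob (usubmx V).
  rewrite /frob mulr_suml; apply: eq_bigr => i _; rewrite !big_ord1 mulr_sumr.
  by apply: eq_bigr => j _; rewrite !mxE big_ord1 sqnM !mxE.
apply: le_trans (@frobD_le R m q 2^-1 _ _ _) _; first by apply/andP; split; lra.
have -> : (1 - 2^-1)^-1 = 2 :> R by field.
rewrite invrK lcol; have := cP _ (dsubmx V).
have h1 := frob_ge0 (lsubmx A); have h2 := frob_ge0 (usubmx V).
have h3 := frob_ge0 (dsubmx V); move=> h4.
have h5 := mulr_ge0 h1 h3; have h6 := mulr_ge0 c0 h2; lra.
Qed.

(** * Rank-one splittings of the space *)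

(** The projection [P] onto the kernel of [u] along [w] is singular because [u *m P = 0]. A rank
    factorization of [P] gives [B] and [C], and cancelling the outer factors in [P *m P = P] gives
    [C *m B = 1%:M]. *)
Lemma split_rank1 (F : fieldType) n (u : 'rV[F]_n) (w : 'cV[F]_n) :
  u *m w = 1%:M ->
  exists m (B : 'M[F]_(n, m)) (C : 'M[F]_(m, n)),
    [/\ (m < n)%N, C *m B = 1%:M & B *m C = 1%:M - w *m u].
Proof.
move=> uw; set P := 1%:M - w *m u.
have PP : P *m P = P.
  rewrite {1}/P mulmxBl mul1mx -mulmxA mulmxBr mulmx1 (mulmxA u) uw mul1mx.
  by rewrite subrr mulmx0 subr0.
exists (\rank P), (col_base P), (row_base P); split; last exact: mulmx_base.
  rewrite ltn_neqAle rank_leq_row andbT; apply/negP => Pfree.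
  have uP : u *m P = 0 by rewrite mulmxBr mulmx1 mulmxA uw mul1mx subrr.
  have u0 : u = 0 by apply: (row_free_inj Pfree); rewrite mul0mx.
  move: uw; rewrite u0 mul0mx => /matrixP/(_ 0 0)/eqP.
  by rewrite !mxE eq_sym oner_eq0.
move: (col_base_full P) (row_base_free P) (mulmx_base P).
move: (col_base P) (row_base P) => B C /row_fullP[L LB] /row_freeP[M CM] BC.
have : L *m ((B *m C) *m (B *m C)) *m M = L *m (B *m C) *m M by rewrite BC PP.
by rewrite -!mulmxA CM !mulmx1 (mulmxA L) LB mul1mx.
Qed.

(* The complex homogeneity is squared because [sqn a] is the squared modulus. *)
Definition is_norm (R : rcfType) n (N : 'cV[R[i]]_n -> R) : Prop :=
  [/\ forall v, 0 <= N v, forall v, N v = 0 -> v = 0,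
      forall a v, N (a *: v) ^+ 2 = sqn a * N v ^+ 2 &
      forall u v, N (u + v) <= N u + N v].

(** * Spectrum of a contraction and its deflations *)

(** The orbit [z + k w] of [z] stays bounded while [k] grows, which forces [N w] to vanish since the
    field is archimedean. *)
Lemma contraction_no_jordan_block (R : realType) n (N : 'cV[R[i]]_n -> R)
    (A : 'M[R[i]]_n) (z w : 'cV[R[i]]_n) :
  is_norm N -> (forall v, N (A *m v) <= N v) ->
  A *m w = w -> A *m z = z + w -> w = 0.
Proof.
move=> [N0 Neq0 NZ ND] NA Aw Az.
have bound k : N (k%:R *: w + z) <= N z.
  elim: k => [|k IHk]; first by rewrite scale0r add0r.
  have -> : k.+1%:R *: w + z = A *m (k%:R *: w + z).
    by rewrite mulmxDr -scalemxAr Aw Az -natr1 scalerDl scale1r -addrA (addrC w).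
  exact: le_trans (NA _) IHk.
have NR (x : R) v : 0 <= x -> N (x%:C *: v) = x * N v.
  by move=> x0; apply/eqP; rewrite -(@eqrXn2 _ 2) ?mulr_ge0 // NZ sqn_real exprMn.
have Nneg v : N (- v) = N v.
  apply/eqP; rewrite -(@eqrXn2 _ 2) // -scaleN1r NZ.
  by rewrite /sqn /= oppr0 sqrrN expr1n expr0n addr0 mul1r.
apply: Neq0; apply/eqP; rewrite eq_le N0 andbT leNgt; apply/negP => w0.
have := archi_boundP (divr_ge0 (addr_ge0 (N0 z) (N0 z)) (ltW w0)).
set k := Num.bound _; rewrite ltr_pdivrMr // ltNge => /negP; apply.
rewrite -NR ?ler0n // rmorph_nat -[_ *: w](addrK z).
by apply: le_trans (ND _ _) _; rewrite Nneg lerD2r.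
Qed.

Lemma norm_eigen_le1 (R : rcfType) n (N : 'cV[R[i]]_n -> R) (A : 'M[R[i]]_n)
    (w : 'cV[R[i]]_n) a :
  is_norm N -> (forall v, N (A *m v) <= N v) ->
  A *m w = a *: w -> w != 0 -> sqn a <= 1.
Proof.
move=> [N0 Neq0 NZ ND] NA Aw w0.
have Nw : 0 < N w by rewrite lt_neqAle N0 andbT; apply: contra_neq w0 => /esym/Neq0.
have := NA w; rewrite Aw -(@ler_pXn2r _ 2) ?nnegrE // NZ.
by rewrite ger_pMl // exprn_gt0.
Qed.

Lemma eigenvalue_tr (F : fieldType) n (A : 'M[F]_n) a :
  eigenvalue A^T a = eigenvalue A a.
Proof.
by rewrite !eigenvalue_root_char /char_poly -[in RHS]det_tr /char_poly_mx
  linearB /= tr_scalar_mx map_trmx.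
Qed.

Lemma right_eigenvector (F : fieldType) n (A : 'M[F]_n) a :
  eigenvalue A a -> exists2 w : 'cV[F]_n, A *m w = a *: w & w != 0.
Proof.
rewrite -eigenvalue_tr => /eigenvalueP[v vA v0]; exists v^T.
  by apply: trmx_inj; rewrite trmx_mul !linearZ /= !trmxK.
by rewrite -trmx0 (inj_eq (@trmx_inj _ _ _)).
Qed.

(** A left eigenvector [x] of the compression lifts to [x *m C + t *: u]. The [u]-component gives a
    scalar equation for [t], solvable because [b - a] is invertible. *)
Lemma eigenvalue_deflate (F : fieldType) n m (A : 'M[F]_n) (u : 'rV[F]_n)
    (w : 'cV[F]_n) (B : 'M[F]_(n, m)) (C : 'M[F]_(m, n)) a b :
  u *m A = a *: u -> u *m B = 0 -> C *m B = 1%:M -> B *m C = 1%:M - w *m u ->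
  eigenvalue (C *m A *m B) b -> b != a -> eigenvalue A b.
Proof.
move=> uA uB CB BC /eigenvalueP[x xCAB x0] ba.
have ba0 : b - a != 0 by rewrite subr_eq0.
pose s := (x *m C *m A *m w) 0 0; pose t := s / (b - a).
have yA : x *m C *m A = b *: (x *m C) + s *: u.
  have -> : x *m C *m A = x *m C *m A *m (B *m C + w *m u).
    by rewrite BC subrK mulmx1.
  rewrite mulmxDr (mulmxA _ w) (mx11_scalar (_ *m w)) mul_scalar_mx.
  by congr (_ + _); rewrite scalemxAl -xCAB !mulmxA.
apply/eigenvalueP; exists (x *m C + t *: u).
  rewrite mulmxDl yA -scalemxAl uA scalerDr -addrA; congr (_ + _).
  rewrite !scalerA -scalerDl; congr (_ *: _).
  by rewrite /t; field.
apply: contra_neq x0 => /(congr1 (mulmx^~ B)).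
by rewrite mulmxDl -mulmxA CB mulmx1 -scalemxAl uB scaler0 addr0 mul0mx.
Qed.

Lemma row_inverse (F : fieldType) n (u : 'rV[F]_n) :
  u != 0 -> exists w : 'cV[F]_n, u *m w = 1%:M.
Proof. by move=> u0; apply/row_freeP; rewrite /row_free rank_rV u0. Qed.

Lemma split_rank1_ker (F : fieldType) n m (u : 'rV[F]_n) (w : 'cV[F]_n)
    (B : 'M[F]_(n, m)) (C : 'M[F]_(m, n)) :
  u *m w = 1%:M -> C *m B = 1%:M -> B *m C = 1%:M - w *m u ->
  u *m B = 0 /\ C *m w = 0.
Proof.
move=> uw CB BC; split.
  rewrite -[u *m B]mulmx1 -CB mulmxA -(mulmxA u) BC mulmxBr mulmxA uw.
  by rewrite mulmx1 mul1mx subrr mul0mx.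
rewrite -[C *m w]mul1mx -CB -mulmxA (mulmxA B) BC mulmxBl -mulmxA uw.
by rewrite mul1mx mulmx1 subrr mulmx0.
Qed.

(** * Quadratic forms that decrease along [A] *)

(** Induction on the dimension. In the coordinates [u *m v] and [C *m v], with [u] a left
    eigenvector, [A] is block triangular: the first coordinate is scaled by [a], the second follows
    the compression [C *m A *m B] plus a coupling to the first. The left inverse [S] witnesses that
    [T] is injective. *)
Lemma strict_lyapunov (R : rcfType) n (A : 'M[R[i]]_n) :
  (forall a, eigenvalue A a -> sqn a < 1) ->
  exists m (T : 'M[R[i]]_(m, n)) (S : 'M[R[i]]_(n, m)) (c : R),
    [/\ 0 <= c < 1, S *m T = 1%:M &
        forall v : 'cV[R[i]]_n, frob (T *m (A *m v)) <= c * frob (T *m v)].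
Proof.
elim/ltn_ind: n A => [[|n]] IHn A eigA.
  exists 0, 0, 0, 0; split; first by rewrite lexx ltr01.
    by apply/matrixP => -[].
  by move=> v; rewrite mul0r /frob big_ord0.
have [a Aa] := eigenvalue_closed A (ltn0Sn n).
have a1 := eigA a Aa; have /eigenvalueP[u uA u0] := Aa.
have [w uw] := row_inverse u0.
have [m [B [C [mn CB BC]]]] := split_rank1 uw.
have [uB Cw] := split_rank1_ker uw CB BC.
have [|m' [T [S [c [/andP[c0 c1] ST TA]]]]] := IHn m mn (C *m A *m B).
  by move=> b bA; have [->//|ba] := eqVneq b a;
    exact/eigA/(eigenvalue_deflate uA uB CB BC bA).
(* Weight [k] on [u *m v] absorbs the coupling term [C *m A *m w]; the parameter
   [t] splits the square of the sum so that [c / (1 - t) < 1]. *)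
pose t := (1 - c) / 2; pose g := frob (T *m (C *m A *m w)).
have g0 : 0 <= g := frob_ge0 _.
have t0 : 0 < t by rewrite /t; lra.
have a0 := sqn_ge0 a.
pose d := 1 - sqn a; have d0 : 0 < d by rewrite /d; lra.
pose k := 1 + 2 * t^-1 * g / d.
have h0 : 0 <= 2 * t^-1 * g / d.
  by rewrite divr_ge0 ?mulr_ge0 ?invr_ge0 // ltW.
have k1 : 1 <= k by rewrite /k; lra.
(* The definition of [k] makes this the inequality [k - 1 <= k ^+ 2]. *)
have tg : t^-1 * g <= k ^+ 2 * (d / 2).
  have -> : t^-1 * g = (k - 1) * (d / 2) by rewrite /k; field; rewrite !gt_eqF.
  by rewrite ler_pM2r; [nra | lra].
exists (1 + m')%N, (col_mx (k%:C *: u) (T *m C)), (row_mx ((k^-1)%:C *: w) (B *m S)).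
(* The first coordinate contracts by [1 - d], and the coupling gives back [d / 2]; the second
   contracts by [c], inflated by the Young factor. *)
pose c1' := 1 - d / 2; pose c2' := c / (1 - t).
have kV : k%:C * (k^-1)%:C = 1 :> R[i].
  by rewrite -rmorphM /= mulfV ?rmorph1 // gt_eqF // (lt_le_trans ltr01).
have c2_1 : 0 <= c2' < 1.
  apply/andP; split; first by rewrite divr_ge0 //; rewrite /t; lra.
  by rewrite ltr_pdivrMr /t; lra.
have c1_1 : 0 <= c1' < 1 by rewrite /c1' /d; apply/andP; split; lra.
exists (1 - (1 - c1') * (1 - c2')); split.
- by move: c2_1 c1_1 => /andP[? ?] /andP[? ?]; apply/andP; split; nra.
- rewrite mul_row_col -!mulmxA (mulmxA S) ST mul1mx BC -scalemxAl -scalemxAr scalerA.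
  by rewrite mulrC kV scale1r addrC subrK.
move=> v; pose x := (u *m v) 0 0; pose y := T *m C *m v.
have uv : u *m v = x%:M by rewrite [LHS]mx11_scalar.
have sc (z : R[i]) : frob (z%:M : 'M_1) = sqn z.
  by rewrite /frob !big_ord1 mxE eqxx mulr1n.
have E1 : frob (col_mx (k%:C *: u) (T *m C) *m v) = k ^+ 2 * sqn x + frob y.
  by rewrite mul_col_mx frob_col_mx -scalemxAl frobZ uv sc sqn_real.
have E2 : T *m C *m (A *m v) = T *m (C *m A *m B *m (C *m v)) +
    x *: (T *m (C *m A *m w)).
  have {1}-> : v = B *m C *m v + w *m u *m v by rewrite BC mulmxBl mul1mx subrK.
  rewrite -(mulmxA w) uv !mulmxDr mul_mx_scalar -!scalemxAr.
  by rewrite !mulmxA.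
rewrite E1 mul_col_mx frob_col_mx -scalemxAl mulmxA uA -scalemxAl uv !frobZ.
rewrite sc sqn_real.
rewrite E2.
have h1 : frob (T *m (C *m A *m B *m (C *m v)) + x *: (T *m (C *m A *m w)))
    <= c2' * frob y + k ^+ 2 * (d / 2) * sqn x.
  apply: le_trans (@frobD_le _ _ _ t _ _ _) _; first by rewrite t0 /t; lra.
  rewrite frobZ lerD //.
    rewrite /c2' [c / _]mulrC -mulrA ler_wpM2l ?invr_ge0 //;
      first by rewrite /t; lra.
    by rewrite /y -(mulmxA T C) TA.
  by rewrite (mulrC (sqn x)) mulrA ler_wpM2r ?sqn_ge0.
have y0 := frob_ge0 y; have x0 := mulr_ge0 (sqr_ge0 k) (sqn_ge0 x).
apply: le_trans (lerD (lexx _) h1) _.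
have -> : k ^+ 2 * (sqn a * sqn x) + (c2' * frob y + k ^+ 2 * (d / 2) * sqn x)
  = c1' * (k ^+ 2 * sqn x) + c2' * frob y by rewrite /c1' /d; field.
move: c2_1 c1_1 => /andP[? ?] /andP[? ?].
by rewrite [leRHS]mulrDr lerD // ler_wpM2r //; nra.
Qed.

(** Induction on the dimension. Without unit eigenvalues, [strict_lyapunov] applies. Otherwise
    matching left and right eigenvectors split off a line on which [A] preserves the modulus, and
    the compression to the complement is again a contraction for a norm. *)
Lemma norm_contraction_similar (R : realType) n (A : 'M[R[i]]_n)
    (N : 'cV[R[i]]_n -> R) :
  is_norm N -> (forall v, N (A *m v) <= N v) ->
  exists m (T : 'M[R[i]]_(m, n)) (S : 'M[R[i]]_(n, m)),
    S *m T = 1%:M /\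
    forall v : 'cV[R[i]]_n, frob (T *m (A *m v)) <= frob (T *m v).
Proof.
elim/ltn_ind: n A N => n IHn A N normN NA.
have eigA1 a : eigenvalue A a -> sqn a <= 1.
  by move=> /right_eigenvector[w Aw w0]; apply: (norm_eigen_le1 normN NA Aw w0).
have [[a [Aa a1]]|noa] :=
  pselect (exists a, eigenvalue A a /\ sqn a = 1); last first.
  have [|m [T [S [c [/andP[c0 c1] ST TA]]]]] := @strict_lyapunov R n A.
    move=> a Aa; rewrite lt_neqAle eigA1 // andbT.
    by apply/eqP => a1; apply: noa; exists a.
  exists m, T, S; split => // v; apply: le_trans (TA v) _.
  by rewrite ler_piMl ?frob_ge0 // ltW.
have a0 : a != 0.
  by apply/eqP => a0; move: a1; rewrite a0 /sqn /= expr0n addr0;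
    move=> /esym/eqP; rewrite oner_eq0.
have [w1 Aw1 w10] := right_eigenvector Aa.
(* If every left [a]-eigenvector killed [w1], then [w1] would be in the range of
   [A - a%:M], which makes a Jordan block of size 2 for the unit eigenvalue [a]. *)
have [u [uA uw1]] : exists u : 'rV_n, u *m A = a *: u /\ u *m w1 != 0.
  pose K := kermx (A - a%:M).
  have KA : K *m A = a *: K.
    by apply/eqP; rewrite -subr_eq0 -mul_mx_scalar -mulmxBr mulmx_ker.
  have [Kw|Kw] := eqVneq (K *m w1) 0; last first.
    have [i rowi] : exists i, row i (K *m w1) != 0.
      by apply/existsP; apply: contraNT Kw => /existsPn H;
        apply/eqP/row_matrixP => i;
        rewrite row0; apply/eqP; move: (H i); rewrite negbK.
    exists (row i K); rewrite -!row_mul; split=> //.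
    by rewrite KA linearZ.
  (* Fredholm alternative: [w1] is in the range of [A - a%:M] because the whole left kernel [K]
     annihilates it. *)
  have [z Az] : exists z, (A - a%:M) *m z = w1.
    have : (w1^T <= (A - a%:M)^T)%MS.
      rewrite submxE -(inj_eq (@trmx_inj _ _ _)) trmx_mul trmxK trmx0; apply/eqP.
      have /sub_kermxP : (cokermx (A - a%:M)^T)^T *m (A - a%:M) = 0.
        by apply: trmx_inj; rewrite trmx_mul trmxK mulmx_coker trmx0.
      by move=> /submxP[D ->]; rewrite -mulmxA Kw mulmx0.
    by move=> /submxP[D wD]; exists D^T; apply: trmx_inj; rewrite trmx_mul trmxK.
  (* Since [a] has modulus 1, dividing by it keeps the contraction and moves the eigenvalue to 1,
     where the Jordan block lemma applies. *)
  have NAa v : N ((a^-1 *: A) *m v) <= N v.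
    rewrite -scalemxAl -(@ler_pXn2r _ 2) ?nnegrE //; case: (normN) => N0 _ NZ _ //.
    have -> : N (a^-1 *: (A *m v)) ^+ 2 = N (A *m v) ^+ 2.
      rewrite NZ -[RHS]mul1r; congr (_ * _); rewrite -[LHS]mul1r -a1 -sqnM mulfV //.
      by rewrite /sqn /= expr0n addr0 expr1n.
    by rewrite ler_pXn2r ?nnegrE.
  exfalso; move/eqP: w10; apply.
  suff : a^-1 *: w1 = 0 by move/eqP; rewrite scaler_eq0 invr_eq0 (negPf a0) => /eqP.
  apply: (@contraction_no_jordan_block R n N (a^-1 *: A) z _ normN NAa).
    by rewrite -scalemxAl -scalemxAr Aw1 !scalerA divfK.
  have {}Az : A *m z = w1 + a *: z by rewrite -Az mulmxBl mul_scalar_mx subrK.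
  by rewrite -scalemxAl Az scalerDr scalerA mulVf // scale1r addrC.
pose s := (u *m w1) 0 0.
have s0 : s != 0.
  by apply: contra_neq uw1 => s0; rewrite [LHS]mx11_scalar -/s s0 raddf0.
pose w := s^-1 *: w1.
have uw : u *m w = 1%:M.
  by rewrite -scalemxAr [u *m w1]mx11_scalar -/s scale_scalar_mx mulVf.
have Aw : A *m w = a *: w by rewrite -scalemxAr Aw1 !scalerA mulrC.
clearbody w.
have [m [B [C [mn CB BC]]]] := split_rank1 uw.
have [uB Cw] := split_rank1_ker uw CB BC.
(* Here [w] is a right eigenvector too, so the coupling term vanishes and the splitting is block
   diagonal. *)
have CAw : C *m A *m w = 0 by rewrite -mulmxA Aw -scalemxAr Cw scaler0.
have BCA v : B *m (C *m A *m B *m v) = A *m (B *m v).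
  rewrite !mulmxA BC mulmxBl mul1mx -(mulmxA w) uA -scalemxAr mulmxBl -scalemxAl.
  by rewrite -(mulmxA w) uB mulmx0 scaler0 subr0.
(* The range of [B] is invariant under [A], so [N] pulled back along the injective [B] is a norm
   contracted by the compression. *)
have [||m' [T [S [ST TA]]]] := IHn m mn (C *m A *m B) (fun v => N (B *m v)).
- case: normN => N0 Neq0 NZ ND; split=> [v|v|b v|v v'] //.
  + by move/Neq0/(congr1 (mulmx C)); rewrite mulmxA CB mul1mx mulmx0.
  + by rewrite -scalemxAr NZ.
  + by rewrite mulmxDr.
- by move=> v; rewrite BCA.
exists (1 + m')%N, (col_mx u (T *m C)), (row_mx w (B *m S)); split.
  rewrite mul_row_col -!mulmxA (mulmxA S) ST mul1mx BC.
  by rewrite addrCA subrr addr0.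
move=> v; rewrite !mul_col_mx !frob_col_mx mulmxA uA -scalemxAl frobZ.
rewrite a1 mul1r lerD2l.
have -> : T *m C *m (A *m v) = T *m (C *m A *m B *m (C *m v)).
  have {1}-> : v = B *m C *m v + w *m u *m v by rewrite BC mulmxBl mul1mx subrK.
  rewrite -(mulmxA w) [u *m v]mx11_scalar mul_mx_scalar !mulmxDr -!scalemxAr.
    rewrite -[T *m C *m (A *m w)]mulmxA (mulmxA C A) CAw mulmx0 scaler0 addr0.
  by rewrite !mulmxA.
by apply: le_trans (TA _) _; rewrite mulmxA.
Qed.

(** * The sup norm and row-stochastic matrices *)

Definition supnorm (R : rcfType) n (v : 'cV[R[i]]_n) : R :=
  \big[Num.max/0]_i Normc.normc (v i 0).

Lemma normc_ge0 (R : rcfType) (z : R[i]) : 0 <= Normc.normc z.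
Proof. by case: z => a b; apply: sqrtr_ge0. Qed.

Lemma normc_sqr (R : rcfType) (z : R[i]) : Normc.normc z ^+ 2 = sqn z.
Proof. by case: z => a b; rewrite sqr_sqrtr // addr_ge0 ?sqr_ge0. Qed.

Lemma supnorm_ge0 (R : rcfType) n (v : 'cV[R[i]]_n) : 0 <= supnorm v.
Proof. exact: bigmax_ge_id. Qed.

Lemma supnormP (R : rcfType) n (v : 'cV[R[i]]_n) i :
  Normc.normc (v i 0) <= supnorm v.
Proof. exact: (le_bigmax 0 (fun i => Normc.normc (v i 0))). Qed.

Lemma supnorm_is_norm (R : rcfType) n : is_norm (@supnorm R n).
Proof.
split=> [v|v v0|a v|u v]; first exact: supnorm_ge0.
- apply/matrixP => i j; rewrite ord1 mxE; apply: Normc.eq0_normc.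
  by apply/eqP; rewrite eq_le normc_ge0 andbT -v0 supnormP.
- have -> : supnorm (a *: v) = Normc.normc a * supnorm v.
    rewrite /supnorm (big_morph _ (fun x y => maxr_pMr x y (normc_ge0 a)) (mulr0 _)).
    by apply: eq_bigr => i _; rewrite mxE Normc.normcM.
  by rewrite exprMn normc_sqr.
- apply: bigmax_le => [|i _]; first by rewrite addr_ge0 ?supnorm_ge0.
  rewrite mxE; apply: le_trans (le_normcD _ _) _.
  by rewrite lerD ?supnormP.
Qed.

(** Each entry of the image is a convex combination of entries of [v]. *)
Lemma supnorm_stochastic (R : realType) n (L : 'M[R]_n) (v : 'cV[R[i]]_n) :
  interconnection L -> supnorm (map_mx (real_complex R) L *m v) <= supnorm v.
Proof.
move=> [L0 L1]; apply: bigmax_le => [|i _]; first exact: supnorm_ge0.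
rewrite mxE -[leRHS]mul1r -(L1 i) mulr_suml.
(* Stated for arbitrary index lists so that the triangle inequality goes through by induction. *)
have : forall s : seq 'I_n,
    Normc.normc (\sum_(j <- s) (map_mx (real_complex R) L) i j * v j 0)
    <= \sum_(j <- s) L i j * supnorm v.
  elim=> [|j s IHs]; first by rewrite !big_nil Normc.normc0.
  rewrite !big_cons; apply: le_trans (le_normcD _ _) _; apply: lerD => //.
  rewrite Normc.normcM mxE /= expr0n addr0 sqrtr_sqr ger0_norm //.
  by rewrite ler_wpM2l ?supnormP.
exact.
Qed.

(** * Stacked vectors as matrices *)

Lemma kpair_proof m n (i : 'I_m) (j : 'I_n) : (i * n + j < m * n)%N.
Proof.
apply: (@leq_trans (i * n + n)%N); first by rewrite ltn_add2l.
by rewrite -mulSnr leq_mul2r ltn_ord orbT.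
Qed.

Definition kpair m n (i : 'I_m) (j : 'I_n) : 'I_(m * n) :=
  Ordinal (kpair_proof i j).

Lemma kdiv_pair m n (i : 'I_m) (j : 'I_n) : kdiv (kpair i j) = i.
Proof.
have n0 : (0 < n)%N by case: n j => [[]|].
by apply: val_inj; rewrite /= divnMDl // divn_small ?addn0.
Qed.

Lemma kmod_pair m n (i : 'I_m) (j : 'I_n) : kmod (kpair i j) = j.
Proof. by apply: val_inj; rewrite /= modnMDl modn_small. Qed.

Lemma kpairK m n (k : 'I_(m * n)) : kpair (kdiv k) (kmod k) = k.
Proof. by apply: val_inj; rewrite /= -divn_eq. Qed.

Lemma sum_kpair (V : nmodType) m n (F : 'I_(m * n) -> V) :
  \sum_k F k = \sum_i \sum_j F (kpair i j).
Proof.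
rewrite pair_bigA /= (reindex (fun q : 'I_m * 'I_n => kpair q.1 q.2)) //=.
exists (fun k => (kdiv k, kmod k)) => [[i j] _|k _] /=; last exact: kpairK.
by rewrite kdiv_pair kmod_pair.
Qed.

(** Row-major reshaping: row [i] is the state of agent [i]. *)
Definition unkron (R : Type) m n (x : 'cV[R]_(m * n)) : 'M[R]_(m, n) :=
  \matrix_(i, j) x (kpair i j) 0.

(** The vectorization identity: a Kronecker product acts on the reshaped matrix by [A] on the left
    and the transpose of [Q] on the right. *)
Lemma unkron_step (R : realType) m n (A : 'M[R]_m) (Q : 'M[R]_n) x :
  unkron ((1%:M + kron A Q) *m x) = unkron x + A *m unkron x *m Q^T.
Proof.
rewrite mulmxDl mul1mx; apply/matrixP => i j; rewrite !mxE; congr (_ + _).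
rewrite sum_kpair exchange_big /=; apply: eq_bigr => b _.
rewrite !mxE mulr_suml; apply: eq_bigr => a _.
by rewrite !mxE !kdiv_pair !kmod_pair mulrAC.
Qed.

(** * Euclidean norm and the eigenvalues of [Q] *)

Lemma vnorm_sqr (R : realType) m (x : 'cV[R]_m) :
  vnorm x ^+ 2 = \sum_i x i 0 ^+ 2.
Proof. by rewrite sqr_sqrtr // sumr_ge0 // => i _; apply: sqr_ge0. Qed.

Lemma frob_unkron (R : realType) m n (x : 'cV[R]_(m * n)) :
  frob (map_mx (real_complex R) (unkron x)) = vnorm x ^+ 2.
Proof.
rewrite vnorm_sqr sum_kpair; apply: eq_bigr => i _; apply: eq_bigr => j _.
by rewrite !mxE sqn_real.
Qed.

Lemma vnorm_gt0 (R : realType) m (x : 'cV[R]_m) : x != 0 -> 0 < vnorm x.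
Proof.
move=> x0; rewrite sqrtr_gt0 lt_neqAle sumr_ge0 ?andbT => [|i _];
  last exact: sqr_ge0.
apply: contra_neq x0 => /esym/psumr_eq0P x0; apply/matrixP => i j.
rewrite ord1 mxE; apply/eqP; rewrite -sqrf_eq0; apply/eqP/x0 => // k _.
exact: sqr_ge0.
Qed.

Lemma vnormZ (R : realType) m a (x : 'cV[R]_m) : vnorm (a *: x) = `|a| * vnorm x.
Proof.
rewrite /vnorm -sqrtr_sqr -sqrtrM ?sqr_ge0 // mulr_sumr; congr Num.sqrt.
by apply: eq_bigr => i _; rewrite mxE exprMn.
Qed.

Lemma dot_vnorm (R : realType) m (x : 'cV[R]_m) : (x^T *m x) 0 0 = vnorm x ^+ 2.
Proof. by rewrite vnorm_sqr mxE; apply: eq_bigr => i _; rewrite mxE expr2. Qed.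

(** Let [a] and [b] be the real and imaginary parts of [z]. Symmetry equates [a^T Q b] with
    [b^T Q a], which leaves the imaginary part of [d] times a positive number equal to 0. Then [a]
    or [b] is a real eigenvector, and semidefiniteness and the norm bound give the two ends of the
    interval. *)
Lemma Qbar_eigenvalue (R : realType) n (Q : 'M[R]_n) (d : R[i])
    (z : 'cV[R[i]]_n) :
  Qbar Q -> z != 0 -> map_mx (real_complex R) Q *m z = d *: z ->
  exists2 t : R, d = t%:C & 0 <= t <= 1.
Proof.
move=> [Qsym [Qpos Qle]] z0 Qz.
pose a := map_mx (@complex.Re R) z; pose b := map_mx (@complex.Im R) z.
have ReM (x y : R[i]) : complex.Re (x * y) =
    complex.Re x * complex.Re y - complex.Im x * complex.Im y by case: x y => ? ? [].
have ImM (x y : R[i]) : complex.Im (x * y) =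
    complex.Re x * complex.Im y + complex.Im x * complex.Re y by case: x y => ? ? [].
have QRe : Q *m a = complex.Re d *: a - complex.Im d *: b.
  apply/matrixP => i j; have /matrixP/(_ i j)/(congr1 (@complex.Re R)) := Qz.
  rewrite !mxE raddf_sum /= ReM => <-.
  by apply: eq_bigr => k _; rewrite ReM !mxE /= mul0r subr0.
have QIm : Q *m b = complex.Re d *: b + complex.Im d *: a.
  apply/matrixP => i j; have /matrixP/(_ i j)/(congr1 (@complex.Im R)) := Qz.
  rewrite !mxE raddf_sum /= ImM => <-.
  by apply: eq_bigr => k _; rewrite ImM !mxE /= mul0r addr0.
have ab0 : (a != 0) || (b != 0).
  rewrite -negb_and; apply: contra z0 => /andP[/eqP a0 /eqP b0]; apply/eqP.
  apply/matrixP => i j; move/matrixP/(_ i j): a0; move/matrixP/(_ i j): b0.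
  by rewrite !mxE; case: (z i j) => x y /= -> ->.
have tr1 (M : 'M[R]_1) : M^T = M by rewrite [M]mx11_scalar tr_scalar_mx.
have ab : b^T *m a = a^T *m b by rewrite -[LHS]tr1 trmx_mul trmxK.
have d0 : complex.Im d = 0.
  have : a^T *m (Q *m b) = b^T *m (Q *m a).
    by rewrite -[LHS]tr1 !trmx_mul trmxK Qsym mulmxA.
  rewrite QRe QIm mulmxDr mulmxBr -!scalemxAr ab => /matrixP/(_ 0 0).
  move: (dot_vnorm a) (dot_vnorm b).
  move: (a^T *m a) (b^T *m b) (a^T *m b) => aa bb e aaE bbE.
  rewrite !mxE aaE bbE => E.
  have n0 : vnorm a ^+ 2 + vnorm b ^+ 2 != 0.
    rewrite paddr_eq0 ?sqr_ge0 // !sqrf_eq0 negb_and.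
    by case/orP: ab0 => /vnorm_gt0/gt_eqF ->; rewrite ?orbT.
  by apply: (mulIf n0); rewrite mul0r mulrDr; lra.
rewrite d0 scale0r subr0 in QRe; rewrite d0 scale0r addr0 in QIm.
have [v v0 Qv] : exists2 v : 'cV_n, v != 0 & Q *m v = complex.Re d *: v.
  by case/orP: ab0 => ?; [exists a | exists b].
have dE : d = (complex.Re d)%:C.
  by apply/eqP; rewrite eq_complex /= d0 !eqxx.
exists (complex.Re d) => //.
have vn := vnorm_gt0 v0; apply/andP; split.
  have := Qpos v; rewrite -mulmxA Qv -scalemxAr mxE dot_vnorm.
  by rewrite pmulr_lge0 // exprn_gt0.
have := Qle v; rewrite Qv vnormZ ler_pM2r //; exact: le_trans (ler_norm _).
Qed.

(** * Monotonicity along a step and the uniform bound *)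

Lemma col_mulmx (F : pzSemiRingType) m n q (A : 'M[F]_(m, n)) (B : 'M[F]_(n, q)) j :
  col j (A *m B) = A *m col j B.
Proof.
by apply/matrixP => i k; rewrite !mxE; apply: eq_bigr => l _; rewrite mxE.
Qed.

(** [T] and [A] act on the left and the diagonalization of [Q] on the right, so one [T] serves every
    [Q]. *)
Lemma frob_step (R : realType) n p m (Q : 'M[R]_n) (A : 'M[R[i]]_p)
    (T : 'M[R[i]]_(m, p)) (X : 'M[R[i]]_(p, n)) :
  Qbar Q ->
  (forall v : 'cV[R[i]]_p, frob (T *m (A *m v)) <= frob (T *m v)) ->
  frob (T *m (X + (A - 1%:M) *m X *m map_mx (real_complex R) Q)) <= frob (T *m X).
Proof.
move=> QQ TA; set QC := map_mx _ Q.
have QCt : map_mx Num.conj QC^T = QC.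
  case: QQ => Qsym _; rewrite map_trmx Qsym; apply/matrixP => i j.
  by rewrite !mxE; apply/conj_Creal/complex_realP; exists (Q i j).
(* The spectral theorem gives complex eigenvalues; [Qbar_eigenvalue] places them in the unit
   interval afterwards. *)
have /orthomx_spectralP : QC \is normalmx by apply/normalmxP; rewrite QCt.
set U := spectralmx QC; set D := spectral_diag QC => QE.
have Uu : U \is unitarymx := spectral_unitarymx QC.
have Uinv : U \in unitmx := unitarymx_unit Uu.
pose W := invmx U.
have Wu : W \is unitarymx by rewrite /W invmx_unitary // trmxC_unitary.
have QW : QC *m W = W *m diag_mx D by rewrite QE mulmxK.
rewrite -[leLHS](frob_unitary _ Wu) -[leRHS](frob_unitary _ Wu) !frob_cols.
apply: ler_sum => j _; set z := col j W.
have Qz : QC *m z = D 0 j *: z.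
  rewrite -col_mulmx QW; apply/matrixP => i k.
  by rewrite !mxE mulrC (bigD1 j) //= big1 ?addr0 => [|l lj];
    rewrite !mxE ?eqxx ?mulr1n // (negPf lj) mulr0n mulr0.
have z0 : z != 0.
  apply/eqP => z0; have : U *m z = 0 by rewrite z0 mulmx0.
  rewrite -col_mulmx mulmxV // => /matrixP/(_ j 0)/eqP.
  by rewrite !mxE eqxx oner_eq0.
have [t dt t01] := Qbar_eigenvalue QQ z0 Qz.
have -> : col j (T *m X *m W) = T *m (X *m z) by rewrite col_mulmx mulmxA.
(* On the eigenvector [z], right multiplication by [QC] is scaling by [t], which turns the update
   into a convex combination. *)
have -> : col j (T *m (X + (A - 1%:M) *m X *m QC) *m W) =
    (1 - t)%:C *: (T *m (X *m z)) + t%:C *: (T *m (A *m (X *m z))).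
  rewrite col_mulmx -/z -mulmxA mulmxDl -mulmxA Qz -scalemxAr dt mulmxBl mul1mx.
  rewrite mulmxBl -mulmxA rmorphB rmorph1 scalerBl scale1r scalerBr mulmxDr.
  rewrite mulmxBr -!scalemxAr.
  by rewrite addrAC -addrA.
apply: le_trans (frob_conv _ _ t01) _; have /andP[t0 t1] := t01.
apply: le_trans (lerD (lexx _) (ler_wpM2l t0 (TA _))) _.
by rewrite -mulrDl subrK mul1r.
Qed.

Unset Implicit Arguments.

Theorem theorem10 (R : realType) (p n : nat) (L : 'M[R]_p) :
  interconnection L ->
  exists alpha : R, 0 < alpha /\
    forall (Q : nat -> 'M[R]_n), (forall k, Qbar (Q k)) ->
    forall (x0 : 'cV[R]_(p * n)) (k : nat),
      vnorm (traj L Q x0 k) <= alpha * vnorm x0.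
Proof.
move=> LL; pose toC q r : 'M[R]_(q, r) -> _ := map_mx (real_complex R).
have [m [T [S [ST TL]]]] :=
  norm_contraction_similar (@supnorm_is_norm R p)
    (fun v => supnorm_stochastic v LL).
have [c c0 cP] := frob_mul_le T; have [c' c'0 c'P] := frob_mul_le S.
have cc1 : 0 <= c' * c + 1 by rewrite addr_ge0 ?mulr_ge0 ?ler01.
(* [c' * c] bounds the squared condition number of [T], which depends on [L] alone; adding 1 keeps
   [alpha] positive even when the product is 0. *)
exists (Num.sqrt (c' * c + 1)); split;
  first by rewrite sqrtr_gt0 ltr_wpDl ?mulr_ge0 ?ltr01.
move=> Q QQ x0 k; set x := traj _ _ _ _.
have step j : frob (T *m toC _ _ (unkron (traj L Q x0 j.+1))) <=
    frob (T *m toC _ _ (unkron (traj L Q x0 j))).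
  rewrite /= unkron_step; case: (QQ j) => -> _.
  by rewrite /toC map_mxD !map_mxM map_mxB map_mx1 frob_step.
have V : frob (T *m toC _ _ (unkron x)) <= frob (T *m toC _ _ (unkron x0)).
  rewrite /x; elim: k {x} => [//|k IHk]; exact: le_trans (step k) IHk.
rewrite -(@ler_pXn2r _ 2) ?nnegrE ?mulr_ge0 ?sqrtr_ge0 // exprMn (sqr_sqrtr cc1).
(* Inserting [S *m T] passes from the Euclidean norm to the monotone quantity; [c'] pays for this
   and [c] for the return at time 0. *)
rewrite -!frob_unkron -[map_mx (real_complex R) (unkron x)]mul1mx -ST -mulmxA.
apply: le_trans (c'P _ _) _; apply: le_trans (ler_wpM2l c'0 V) _.
apply: le_trans (ler_wpM2l c'0 (cP _ _)) _.
by rewrite mulrA ler_wpM2r ?frob_ge0 // lerDl.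
Qed.
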